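(* Let $S=\{s_2,s_1\}$ with $s_1>s_2>s_1/2$ positive integers, and let $\alpha=s_1-s_2$. Then the cumulative subtraction game $S$ converges, with $$\xi(S)=s_1\left\lceil\frac{s_2}{\alpha}\right\rceil+s_2\left\lceil\frac{s_1}{\alpha}\right\rceil-2s_2=(s_1+s_2)\left\lceil\frac{s_2}{\alpha}\right\rceil-s_2 .$$
   Context: Cumulative subtraction (CS): $S$ is a finite set of positive integers with $|S|\ge 2$. Starting from a heap of $x\in\mathbb{Z}_{\ge 0}$ pebbles and score $0$, two players, Positive (who starts) and Negative, alternate in removing $s\in S$ pebbles, with $s$ at most the current heap size; Positive's move adds $s$ to the score and Negative's move subtracts $s$. The game ends when the heap is smaller than $\min S$. Positive maximizes and Negative minimizes the terminal score. Outcome function: $o:\mathbb{Z}_{\ge 0}\to\mathbb{Z}$ is defined recursively by $o(x)=0$ if $x<\min S$ and $o(x)=\max\{s-o(x-s)\mid s\in S,\ s\le x\}$ if $x\ge\min S$. Optimal action: for $x\ge\min S$, $\mathrm{opt}(x)$ is the largest $s\in S$ with $s\le x$ and $o(x)=s-o(x-s)$. Convergence: the game $S$ converges at position $x>0$ if $\mathrm{opt}(y)$ is constant over all $y\ge x$, but $\mathrm{opt}(x-1)\neq\mathrm{opt}(y)$ for $y\ge x$; this $x$ is denoted $\xi(S)$. *)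

(* Defs.v *)
From HB Require Import structures.
From mathcomp Require Import all_boot all_order all_algebra.
From mathcomp Require Import finmap.
From Stdlib Require Import ClassicalEpsilon.

Set Implicit Arguments.
Unset Strict Implicit.
Unset Printing Implicit Defensive.

Import Order.TTheory GRing.Theory Num.Theory.

Local Open Scope fset_scope.
Local Open Scope ring_scope.

(* Cumulative subtraction on a set S of positive integers. The definitions
   below are meant for nonempty S with 0 \notin S. *)

(* The seed of each big operator is an element of the list itself, so these are
   the genuine extrema of a nonempty list, whatever the signs. *)
Definition seqmin (l : seq nat) : nat := \big[minn/head 0%N l]_(s <- l) s.
Definition seqmax (l : seq int) : int := \big[Num.max/head 0 l]_(v <- l) v.

Definition min_move (S : {fset nat}) : nat := seqmin S.

(* Course-of-values recursion by fuel n; any n > x yields the same value at x,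
   and lemma outcomeE below is the defining recursion. *)
Fixpoint outcome_rec (S : {fset nat}) (n x : nat) : int :=
  if n is n'.+1 then
    if (x < min_move S)%N then 0
    else seqmax [seq s%:Z - outcome_rec S n' (x - s)%N | s <- S & (s <= x)%N]
  else 0.

Definition outcome (S : {fset nat}) (x : nat) : int := outcome_rec S x.+1 x.

Lemma outcome_rec_stable (S : {fset nat}) (n m x : nat) :
  0%N \notin S -> (x < n)%N -> (x < m)%N ->
  outcome_rec S n x = outcome_rec S m x.
Proof.
move=> S0; elim: n m x => [//|n IHn] [//|m] x ltxn ltxm /=.
case: ifP => // _; congr seqmax; apply/eq_in_map => s.
rewrite mem_filter => /andP[lesx sS].
have s_gt0 : (0 < s)%N by rewrite lt0n; apply: contraNneq S0 => <-.
have ltB : (x - s < x)%N by rewrite ltn_subrL s_gt0 (leq_trans s_gt0 lesx).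
by congr (_ - _); apply: IHn; apply: leq_trans ltB _.
Qed.

Lemma outcomeE (S : {fset nat}) (x : nat) : 0%N \notin S ->
  outcome S x =
  if (x < min_move S)%N then 0
  else seqmax [seq s%:Z - outcome S (x - s)%N | s <- S & (s <= x)%N].
Proof.
move=> S0; rewrite {1}/outcome /=; case: ifP => // _.
congr seqmax; apply/eq_in_map => s; rewrite mem_filter => /andP[lesx sS].
have s_gt0 : (0 < s)%N by rewrite lt0n; apply: contraNneq S0 => <-.
have ltB : (x - s < x)%N by rewrite ltn_subrL s_gt0 (leq_trans s_gt0 lesx).
by congr (_ - _); apply: outcome_rec_stable.
Qed.

(* None where no move is available, so that the optimal action is undefined. *)
Definition opt (S : {fset nat}) (x : nat) : option nat :=
  if (x < min_move S)%N then None
  else Some (\max_(s <- S | (s <= x)%N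
                            && (outcome S x == s%:Z - outcome S (x - s)%N)) s).

(* If x = min_move S, opt S x.-1 is undefined and counts as different from the
   eventual action. *)
Definition converges_at (S : {fset nat}) (x : nat) : Prop :=
  [/\ (0 < x)%N,
      exists s : nat, forall y : nat, (x <= y)%N -> opt S y = Some s &
      forall y : nat, (x <= y)%N -> opt S x.-1 <> opt S y].

Definition converges (S : {fset nat}) : Prop :=
  exists x : nat, converges_at S x.

(* The position of convergence (unspecified if S does not converge); it is
   unique by lemma xiE. *)
Definition xi (S : {fset nat}) : nat := epsilon (inhabits 0%N) (converges_at S).

Lemma converges_at_uniq (S : {fset nat}) (x y : nat) :
  converges_at S x -> converges_at S y -> x = y.
Proof.
have lt_absurd a b : (a < b)%N -> converges_at S a -> converges_at S b -> False.
  move=> ltab [_ [s optE] _] [_ _ neq].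
  apply: (neq b (leqnn b)); rewrite !optE //; first exact: ltnW.
  by rewrite -ltnS (ltn_predK ltab).
move=> cx cy; case: (ltngtP x y) => // lt.
- by case: (lt_absurd x y).
- by case: (lt_absurd y x).
Qed.

Lemma xiE (S : {fset nat}) (x : nat) : converges_at S x -> xi S = x.
Proof.
move=> cx; apply: (converges_at_uniq _ cx).
by apply: epsilon_spec; exists x.
Qed.

(* Main.v *)
(* Put a = s1, b = s2, d = a - b.  Playing a at x is optimal iff
   o (x - a) - o (x - a + d) <= d.  For q * d < b the block of length a + b
   starting at q * (a + b) has an explicit shape: o descends by steps of d from
   q * d to 0 on the first b positions, equals b - q * d on the next d, and
   climbs from a - q * d to a on the last b.  There b is the unique optimal move
   exactly on the d middle positions.  In the last such block the increments
   o (y + d) - o y are at most d in absolute value, which greedy play then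
   preserves, so a stays optimal after the last middle interval. *)

Require Import Defs.
From HB Require Import structures.
From mathcomp Require Import all_boot all_order all_algebra.
From mathcomp Require Import finmap zify.

Import Order.TTheory GRing.Theory Num.Theory.

Local Open Scope ring_scope.

(** * Extrema of lists, and the set of two moves *)

Lemma head_in (T : eqType) (x0 x : T) (l : seq T) : x \in l -> head x0 l \in l.
Proof. by case: l => // y l _; rewrite /= mem_head. Qed.

Lemma seqmax_eq (l : seq int) (m : int) :
  m \in l -> (forall v, v \in l -> v <= m) -> seqmax l = m.
Proof.
move=> ml lem; apply/le_anti/andP; split.
  rewrite /seqmax big_seq; apply: bigmax_le => //.
  exact/lem/(head_in _ _ _ _ ml).
exact: (le_bigmax_seq _ m).
Qed.

Lemma seqmin_le (l : seq nat) (m : nat) : m \in l -> (seqmin l <= m)%N.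
Proof.
rewrite /seqmin; move: (head _ l) => i; elim: l => // s l IHl.
rewrite inE big_cons => /orP[/eqP ->|/IHl]; lia.
Qed.

Lemma seqmin_eq (l : seq nat) (m : nat) :
  m \in l -> (forall s, s \in l -> (m <= s)%N) -> seqmin l = m.
Proof.
move=> ml lem; apply/anti_leq; rewrite seqmin_le //= /seqmin big_seq.
apply: (big_ind (leq m)) => //; first exact/lem/(head_in _ _ _ _ ml).
by move=> x y mx my; rewrite leq_min mx.
Qed.

Lemma min_move2 (s1 s2 : nat) : (s2 < s1)%N -> min_move [fset s2; s1]%fset = s2.
Proof.
move=> lt21; apply: seqmin_eq => [|s]; rewrite !inE ?eqxx //.
by case/orP=> /eqP ->; rewrite // ltnW.
Qed.

Lemma zero_notin2 (s1 s2 : nat) :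
  (0 < s2 < s1)%N -> 0%N \notin [fset s2; s1]%fset.
Proof. rewrite !inE; lia. Qed.

(** The list behind a finite set comes in an unspecified order, so the maximum defining [opt] is
    unfolded only after this permutation. *)
Lemma perm_enum_fset2 (s1 s2 : nat) :
  (s2 < s1)%N -> perm_eq [fset s2; s1]%fset [:: s2; s1].
Proof.
move=> lt21; apply: uniq_perm; rewrite ?fset_uniq //= ?inE ?andbT; first by lia.
by move=> s; rewrite !inE.
Qed.

(** * Outcome and optimal action for two moves *)

Section TwoMoves.

Variables (s1 s2 : nat).
Hypothesis lt21 : (0 < s2 < s1)%N.

Let S : {fset nat} := [fset s2; s1]%fset.
Let o := outcome S.

Lemma outcome2_lt x : (x < s2)%N -> o x = 0.
Proof.
move=> ltx; rewrite /o outcomeE ?zero_notin2 // min_move2 ?ltx //; lia.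
Qed.

Lemma outcome2_mid x : (s2 <= x < s1)%N -> o x = s2%:Z - o (x - s2)%N.
Proof.
move=> xP; rewrite {1}/o outcomeE ?zero_notin2 // min_move2; last by lia.
rewrite ifF; last by lia.
apply: seqmax_eq.
  by apply/mapP; exists s2 => //; rewrite mem_filter !inE eqxx; lia.
move=> v /mapP[s]; rewrite mem_filter !inE => sP ->.
have -> : s = s2 by lia.
by [].
Qed.

Lemma outcome2_ge x : (s1 <= x)%N ->
  o x = Num.max (s1%:Z - o (x - s1)%N) (s2%:Z - o (x - s2)%N).
Proof.
move=> xP; rewrite {1}/o outcomeE ?zero_notin2 // min_move2; last by lia.
rewrite ifF; last by lia.
apply: seqmax_eq.
  apply/mapP; rewrite /Num.max; case: ifP => _.
    by exists s2 => //; rewrite mem_filter !inE eqxx; lia.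
  by exists s1 => //; rewrite mem_filter !inE eqxx; lia.
move=> v /mapP[s]; rewrite mem_filter !inE => /andP[_ /orP[]/eqP -> ->].
  by rewrite le_max lexx orbT.
by rewrite le_max lexx.
Qed.

Lemma opt2_mid x : (s2 <= x < s1)%N -> opt S x = Some s2.
Proof.
move=> xP; rewrite /opt min_move2; last by lia.
rewrite ifF; last by lia.
rewrite (perm_big _ (perm_enum_fset2 s1 s2 _)) /=; last by lia.
rewrite !big_cons big_nil -/o -outcome2_mid // eqxx; congr Some.
case: ifP; case: ifP; lia.
Qed.

(** The comparison is non-strict because [opt] breaks ties in favour of the larger move. *)
Lemma opt2_ge x : (s1 <= x)%N ->
  opt S x = Some (if s2%:Z - o (x - s2)%N <= s1%:Z - o (x - s1)%N
                  then s1 else s2).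
Proof.
move=> xP; rewrite /opt min_move2; last by lia.
rewrite ifF; last by lia.
rewrite (perm_big _ (perm_enum_fset2 s1 s2 _)) /=; last by lia.
rewrite !big_cons big_nil -/o outcome2_ge //; congr Some.
case: (leP (s2%:Z - _)); repeat case: ifP; lia.
Qed.

End TwoMoves.

(** * Shape of the outcome on the initial blocks *)

Section Blocks.

Variables (b d : nat).
Hypothesis ltdb : (0 < d < b)%N.

Let a := (b + d)%N.
Let S : {fset nat} := [fset b; a]%fset.
Let o := outcome S.

Let lt_ba : (0 < b < a)%N.
Proof. rewrite /a; lia. Qed.

Let o_lt x : (x < b)%N -> o x = 0.
Proof. exact: outcome2_lt. Qed.

Let o_mid x : (b <= x < a)%N -> o x = b%:Z - o (x - b)%N.
Proof. exact: outcome2_mid. Qed.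

Let o_ge x : (a <= x)%N ->
  o x = Num.max (a%:Z - o (x - a)%N) (b%:Z - o (x - b)%N).
Proof. exact: outcome2_ge. Qed.

Lemma divnBd r : (d <= r)%N -> (r %/ d = ((r - d) %/ d).+1)%N.
Proof.
move=> ler; rewrite -{1}(subnK ler) divnDr // divnn; lia.
Qed.

(** Follows from [(q - 1) * d < b - d <= r]. Hence [d * (q - r %/ d)] is at most [d] on the last [d]
    positions below [b]. *)
Lemma divn_ge_pred q r : (q * d < b)%N -> (b <= r + d)%N -> (q <= (r %/ d).+1)%N.
Proof.
move=> ltq ler; case: q ltq => // q ltq; rewrite ltnS leq_divRL; last by lia.
by move: ltq; rewrite mulSn; lia.
Qed.

(** The subtraction [q - r %/ d] is truncated, which stops the descent at 0 and the climb at [a]. *)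
Definition block_shape (q : nat) : Prop :=
  [/\ forall r, (r < b)%N -> o (q * (a + b) + r)%N = (d * (q - r %/ d))%N,
      forall r, (b <= r < a)%N -> o (q * (a + b) + r)%N = b%:Z - (q * d)%N%:Z &
      forall r, (r < b)%N ->
        o (q * (a + b) + a + r)%N = a%:Z - (d * (q - r %/ d))%N%:Z].

(** Both moves lead back into block [q], and [a] gains at least [d] over [b]: for [r < d] it lands
    in the middle, otherwise [d] positions lower on the same climb. *)
Lemma block_low q : ((q.+1) * d < b)%N -> block_shape q ->
  forall r, (r < b)%N -> o (q.+1 * (a + b) + r)%N = (d * (q.+1 - r %/ d))%N.
Proof.
move=> ltq [_ Hm Hh] r ltr; rewrite o_ge; last by lia.
have -> : (q.+1 * (a + b) + r - b = q * (a + b) + a + r)%N by lia.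
rewrite Hh //; case: (ltnP r d) => [ltrd | ledr].
  have -> : (q.+1 * (a + b) + r - a = q * (a + b) + (b + r))%N by lia.
  rewrite Hm; last by lia.
  rewrite divn_small // !subn0; lia.
have -> : (q.+1 * (a + b) + r - a = q * (a + b) + a + (r - d))%N by lia.
rewrite Hh; last by lia.
rewrite (divnBd r) // subSS !mulnBr; lia.
Qed.

Lemma block_mid0 r : (b <= r < a)%N -> o r = b.
Proof.
by move=> rP; rewrite o_mid //= o_lt; [rewrite subr0|lia].
Qed.

(** Playing [a] lands on the last [d] positions of block [q], where the climb has reached [a], and
    so yields 0; playing [b] yields [b - q.+1 * d], which is positive. *)
Lemma block_midS q : (q.+1 * d < b)%N -> block_shape q ->
  (forall r, (r < b)%N ->
     o (q.+1 * (a + b) + r)%N = (d * (q.+1 - r %/ d))%N) ->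
  forall r, (b <= r < a)%N ->
    o (q.+1 * (a + b) + r)%N = b%:Z - (q.+1 * d)%N%:Z /\
    opt S (q.+1 * (a + b) + r)%N = Some b.
Proof.
move=> ltq [_ _ Hh] Hl r rP.
have ob : o (q.+1 * (a + b) + r - b)%N = (q.+1 * d)%N.
  have -> : (q.+1 * (a + b) + r - b = q.+1 * (a + b) + (r - b))%N by lia.
  by rewrite Hl ?divn_small ?subn0; lia.
have oa : b%:Z - (q.+1 * d)%N%:Z > a%:Z - o (q.+1 * (a + b) + r - a)%N.
  have -> : (q.+1 * (a + b) + r - a = q * (a + b) + a + (r + b - a))%N by lia.
  rewrite Hh; last by lia.
  have := divn_ge_pred q.+1 (r + b - a) ltq ltac:(lia).
  rewrite ltnS -subn_eq0 => /eqP ->; lia.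
split; first by rewrite o_ge ?ob; lia.
by rewrite opt2_ge -/o ?ob; [rewrite leNgt oa | lia | lia].
Qed.

(** While [r + d < b], [a] ties with [b] or beats it by [d]. Otherwise [b] leads to the middle and
    yields [q * d < b], while [a] yields at least [a - d = b]. *)
Lemma block_high q : (q * d < b)%N ->
  (forall r, (r < b)%N -> o (q * (a + b) + r)%N = (d * (q - r %/ d))%N) ->
  (forall r, (b <= r < a)%N -> o (q * (a + b) + r)%N = b%:Z - (q * d)%N%:Z) ->
  forall r, (r < b)%N ->
    o (q * (a + b) + a + r)%N = a%:Z - (d * (q - r %/ d))%N%:Z.
Proof.
move=> ltq Hl Hm r ltr; rewrite o_ge; last by lia.
have -> : (q * (a + b) + a + r - a = q * (a + b) + r)%N by lia.
have -> : (q * (a + b) + a + r - b = q * (a + b) + (r + d))%N by lia.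
rewrite Hl //; case: (ltnP (r + d) b) => [ltrd | lebr].
  rewrite Hl // (divnBd (r + d)) ?leq_addl // addnK !mulnBr; lia.
rewrite Hm; last by lia.
have := divn_ge_pred q r ltq lebr; rewrite !mulnBr; nia.
Qed.

Lemma block_shapeP q : (q * d < b)%N -> block_shape q.
Proof.
elim: q => [|q IHq] ltq.
  have Hl r : (r < b)%N -> o (0 * (a + b) + r)%N = (d * (0 - r %/ d))%N.
    by move=> ltr; rewrite o_lt // muln0.
  have Hm r : (b <= r < a)%N -> o (0 * (a + b) + r)%N = b%:Z - (0 * d)%N%:Z.
    by move=> rP; rewrite block_mid0 // subr0.
  by split=> //; apply: block_high.
have Hq : block_shape q by apply: IHq; lia.
have Hl := block_low q ltq Hq.
have Hm r rP := (block_midS q ltq Hq Hl r rP).1.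
by split=> //; apply: block_high.
Qed.

Lemma opt_block_mid q r : (q * d < b)%N -> (b <= r < a)%N ->
  opt S (q * (a + b) + r)%N = Some b.
Proof.
case: q => [|q] ltq rP; first by rewrite opt2_mid //; lia.
have Hq : block_shape q by apply: block_shapeP; lia.
exact: (block_midS q ltq Hq (block_low q ltq Hq) r rP).2.
Qed.

(** Lastness of the block matters when [y] is low and [y + d] is in the middle: the outcome is 0 or
    [d] at [y], and [b - q * d] at [y + d], which [b <= q.+1 * d] keeps at most [d]. *)
Lemma step_le_last q y : (q * d < b <= q.+1 * d)%N ->
  (q * (a + b) <= y < q * (a + b) + a)%N -> `|o (y + d)%N - o y| <= d%:Z.
Proof.
move=> /andP[ltq leq] yP.
have [Hl Hm Hh] := block_shapeP q ltq.
have [r yE] : exists r, y = (q * (a + b) + r)%N.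
  by exists (y - q * (a + b))%N; lia.
have {yP} ltra : (r < a)%N by lia.
rewrite {}yE -addnA; case: (ltnP (r + d) b) => [ltrd|lebr].
  rewrite !Hl; [|lia|lia].
  rewrite (divnBd (r + d)) ?leq_addl // addnK !mulnBr; lia.
case: (ltnP r b) => [ltrb|lerb].
  rewrite (Hl r) // Hm; last by lia.
  have := divn_ge_pred q r ltq lebr; rewrite !mulnBr; nia.
have -> : (q * (a + b) + (r + d) = q * (a + b) + a + (r - b))%N by lia.
rewrite Hm ?Hh; [|lia|lia].
by rewrite divn_small ?subn0; lia.
Qed.

(** * Greedy play on the tail, and convergence *)

Lemma outcome_greedy x : (a <= x)%N ->
  `|o (x - a + d)%N - o (x - a)%N| <= d%:Z ->
  o x = a%:Z - o (x - a)%N /\ opt S x = Some a.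
Proof.
move=> leax; have -> : (x - a + d = x - b)%N by lia.
move=> leo; split; first by rewrite o_ge; lia.
by rewrite opt2_ge -/o ?ifT //; lia.
Qed.

(* Past a greedy move the increments o (y + d) - o y merely change sign, so a
   bound on one window of length a propagates to the whole tail. *)
Lemma step_le_tail q y : (q * d < b <= q.+1 * d)%N ->
  (q * (a + b) <= y)%N -> `|o (y + d)%N - o y| <= d%:Z.
Proof.
move=> qP; have [n] := ubnP y; elim: n y => // n IHn y ltyn ley.
case: (ltnP y (q * (a + b) + a)) => [lty | gey].
  by apply: (step_le_last q) => //; rewrite ley.
have D1 := IHn (y - a)%N ltac:(lia) ltac:(lia).
have D2 := IHn (y + d - a)%N ltac:(lia) ltac:(lia).
rewrite (outcome_greedy y _ D1).1; last by lia.
rewrite (outcome_greedy (y + d)%N _ D2).1; last by lia.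
have E : (y + d - a = y - a + d)%N by lia.
by move: D1; rewrite E; lia.
Qed.

Lemma converges_at_two_moves q : (q * d < b <= q.+1 * d)%N ->
  converges_at S (q * (a + b) + a)%N.
Proof.
move=> qP.
have optE y : (q * (a + b) + a <= y)%N -> opt S y = Some a.
  move=> ley; apply: (outcome_greedy y _ (step_le_tail q (y - a)%N qP _)).2; lia.
split; [lia | by exists a |].
move=> y ley; rewrite (optE y) //.
(* The predecessor is the last middle position of block [q]. *)
have -> : (q * (a + b) + a).-1 = (q * (a + b) + a.-1)%N by lia.
rewrite opt_block_mid; [|lia|lia].
by case; lia.
Qed.

End Blocks.

(** * Ceilings and the closed formula *)

Lemma ceil_ratio (b d q : nat) : (0 < d)%N -> (q * d < b <= q.+1 * d)%N ->
  Num.ceil (b%:R / d%:R : rat) = q.+1%:Z.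
Proof.
move=> d0 /andP[lt le]; apply: ceil_def.
have d0' : 0 < d%:R :> rat by rewrite ltr0n.
rewrite ltr_pdivlMr // ler_pdivrMr //.
have -> : q.+1%:Z - 1 = q%:Z by lia.
by rewrite !pmulrn -!natrM ltr_nat ler_nat lt le.
Qed.

Theorem mainTheorem7 (s1 s2 : nat) (hs1 : (0 < s1)%N) (hs2 : (0 < s2)%N)
    (h21 : (s2 < s1)%N) (h12 : s1%:R / 2 < s2%:R :> rat) :
  let S : {fset nat} := [fset s2; s1]%fset in
  let alpha : rat := s1%:R - s2%:R in
  [/\ converges S,
      (xi S)%:Z = s1%:Z * Num.ceil (s2%:R / alpha)
                  + s2%:Z * Num.ceil (s1%:R / alpha) - 2 * s2%:Z &
      s1%:Z * Num.ceil (s2%:R / alpha)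
        + s2%:Z * Num.ceil (s1%:R / alpha) - 2 * s2%:Z
      = (s1%:Z + s2%:Z) * Num.ceil (s2%:R / alpha) - s2%:Z].
Proof.
move=> S alpha.
(* With [d = s1 - s2] this says [d < s2], as the blocks require. *)
have h12n : (s1 < s2 * 2)%N.
  by rewrite -(ltr_nat rat) natrM -ltr_pdivrMr.
(* Dividing [s2.-1] rather than [s2] makes [q.+1] the ceiling of [s2 / d] also when [d] divides
   [s2]. *)
set d := (s1 - s2)%N; set q := (s2.-1 %/ d)%N.
have d0 : (0 < d)%N by rewrite subn_gt0.
have alphaE : alpha = d%:R by rewrite /alpha natrB // ltnW.
have s1E : s1 = (s2 + d)%N by rewrite subnKC // ltnW.
have qP : (q * d < s2 <= q.+1 * d)%N.
  have := leq_divM s2.-1 d; have := ltn_ceil s2.-1 d0; rewrite -/q; lia.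
have cS : converges_at S (q * (s1 + s2) + s1)%N.
  by rewrite /S s1E; apply: converges_at_two_moves => //; lia.
have ceil2 : Num.ceil (s2%:R / alpha) = q.+1%:Z by rewrite alphaE; apply: ceil_ratio.
(* The ratio [s1 / d] exceeds [s2 / d] by exactly 1. *)
have ceil1 : Num.ceil (s1%:R / alpha) = q.+2%:Z.
  by rewrite alphaE; apply: ceil_ratio => //; rewrite s1E; lia.
rewrite (xiE cS) ceil2 ceil1; split; [by exists (q * (s1 + s2) + s1)%N|lia|lia].
Qed.
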